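(* Let $k\geq 2$ be an integer and let $G$ be a $k$-connected $\Delta$-regular graph with $n$ vertices and diameter $D$. Put $$B_1=\frac{1}{n\left(D-\frac{1}{4}\right)},\qquad B_2=\frac{2(k-1)^{2}}{2(n-\Delta)(n-\Delta+2k-4)+(n+1)(k-1)^{2}}.$$ Then: (i) if $k>2\sqrt{\dfrac{(n-\Delta)(n+\Delta-4)}{n(4D-3)-2}}+1$, then $B_2>B_1$; (ii) if $k<\dfrac{2(n-\Delta)}{\sqrt{n(4D-3)-2}}+1$, then $B_1>B_2$.
   Context: All graphs are finite, undirected and simple. The (vertex) connectivity $\kappa(G)$ of $G$ is the minimum number of vertices whose removal disconnects $G$ or reduces it to a single vertex; $G$ is $k$-connected if $\kappa(G)\geq k$. The diameter of $G$ is the maximum distance between two vertices of $G$. The quantities $B_1$ and $B_2$ are two lower bounds for $2\Delta-q(H)$, where $H$ is a proper subgraph of $G$ and $q(H)$ is the largest eigenvalue of the signless Laplacian matrix of $H$ (degree diagonal matrix plus adjacency matrix); a lower bound is ''better'' when it is larger. *)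

(* Defs.v *)
From mathcomp Require Import all_boot all_order all_algebra.

Set Implicit Arguments.
Unset Strict Implicit.
Unset Printing Implicit Defensive.

Import Order.TTheory GRing.Theory Num.Theory.

(* A graph is an edge relation [e] on its finite vertex type [T]. *)
Section Graphs.
Variables (T : finType) (e : rel T).

Definition simple_graph : Prop := symmetric e /\ irreflexive e.

Definition degree (x : T) : nat := #|[set y | e x y]|.

Definition regular (d : nat) : Prop := forall x : T, degree x = d.

(* Edge relation of the graph obtained by deleting the vertices of [S]; its
   vertex set is [~: S]. *)
Definition del_rel (S : {set T}) : rel T :=
  [rel x y | [&& x \notin S, y \notin S & e x y]].

Definition disconnects (S : {set T}) : bool :=
  [exists x, exists y,
    [&& x \notin S, y \notin S & ~~ connect (del_rel S) x y]].

(* The default value [#|T|] never counts on a nonempty graph, where deleting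
   all vertices but one is always admissible and costs [#|T|.-1]. *)
Definition connectivity : nat :=
  \big[minn/#|T|]_(S : {set T} | disconnects S || (#|~: S| == 1)) #|S|.

Definition k_connected (k : nat) : Prop := k <= connectivity.

Definition walk_of_length (x y : T) (d : nat) : bool :=
  [exists p : d.-tuple T, path e x p && (last x p == y)].

(* Length of a shortest walk.  Distances between connected vertices are smaller
   than [#|T|]; the value is [#|T|] when [y] is not reachable from [x]. *)
Definition distance (x y : T) : nat :=
  find (walk_of_length x y) (iota 0 #|T|).

Definition diameter : nat := \max_(x : T) \max_(y : T) distance x y.

End Graphs.

Local Open Scope ring_scope.

Definition B1 (R : rcfType) (n D : nat) : R :=
  1 / (n%:R * (D%:R - 1 / 4)).

(* All subtractions take place in [R], none is truncated. *)
Definition B2 (R : rcfType) (n Delta k : nat) : R :=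
  (2 * (k%:R - 1) ^+ 2) /
  (2 * (n%:R - Delta%:R) * (n%:R - Delta%:R + 2 * k%:R - 4)
   + (n%:R + 1) * (k%:R - 1) ^+ 2).

(* Main.v *)
Require Import Defs.
From mathcomp Require Import all_boot all_order all_algebra.
From mathcomp Require Import ring lra.

Set Implicit Arguments.
Unset Strict Implicit.
Unset Printing Implicit Defensive.

Import Order.TTheory GRing.Theory Num.Theory.
Local Open Scope ring_scope.

(** Put c = k - 1, m = n - Delta and X = n (4 D - 3) - 2.  Clearing the positive
    denominators turns the comparison of [B1] and [B2] into the comparison of
    4 m (m + 2 c - 2) and c^2 X ([B1_lt_B2E] and [B2_lt_B1E]), where
    m + 2 c - 2 = n - Delta + 2 k - 4.  Both thresholds come from replacing the
    factor m + 2 c - 2, which involves k, by a bound that does not: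
    - it is at most n + Delta - 4, because k <= Delta: the neighbourhood of a
      vertex is a vertex cut or leaves a single vertex ([k_connected_degree]).
      The hypothesis of (i) says that c^2 X > 4 m (n + Delta - 4);
    - it is at least m, because c >= 1.  The hypothesis of (ii) says that
      c^2 X < 4 m^2.
    The signs needed on the way (X > 0, m > 0, positive denominators) follow
    from 2 <= k <= Delta < n and D >= 1. *)

(** * Connectivity, degree and diameter *)

Section GraphFacts.
Variables (T : finType) (e : rel T).

Lemma connectivity_le (S : {set T}) :
  disconnects e S || (#|~: S| == 1%N) -> (connectivity e <= #|S|)%N.
Proof.
by move=> hS; rewrite /connectivity -minEnat -leEnat; apply: bigmin_le_cond.
Qed.

Lemma k_connected_nonempty k : (0 < k)%N -> k_connected e k -> (0 < #|T|)%N.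
Proof.
move=> k_gt0 hk; apply: leq_trans (leq_trans k_gt0 hk) _.
by rewrite /connectivity -minEnat -leEnat; apply: bigmin_le_id.
Qed.

Lemma degree_lt_card x : irreflexive e -> (degree e x < #|T|)%N.
Proof.
move=> irr; apply: (@leq_ltn_trans #|[set~ x]|).
  apply/subset_leq_card/subsetP => y; rewrite !inE => exy.
  by apply: contraTneq exy => ->; rewrite irr.
by rewrite cardsC1 prednK //; apply/card_gt0P; exists x.
Qed.

(** Deleting the neighbourhood of [x] isolates [x]: either another vertex
    survives, and is then unreachable from [x], or [x] alone remains. *)
Lemma k_connected_degree k x :
  irreflexive e -> k_connected e k -> (k <= degree e x)%N.
Proof.
move=> irr hk; apply: leq_trans hk _; apply: connectivity_le.
set S := [set y | e x y].
have xNS : x \notin S by rewrite inE irr.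
case: (set_0Vmem (~: S :\ x)) => [S0 | [y]]; last first.
  rewrite !inE => /andP[y_neq_x yNS]; apply/orP; left.
  apply/existsP; exists x; apply/existsP; exists y; rewrite xNS inE yNS /=.
  apply/negP => /connectP[[|z p] /=]; first by move=> _ /eqP; apply/negP.
  by case/andP=> /and3P[_ zNS exz]; rewrite inE exz in zNS.
by rewrite (cardsD1 x) S0 cards0 in_setC xNS orbT.
Qed.

(** The empty walk joins no two distinct vertices. *)
Lemma distance_gt0 x y : x != y -> (0 < distance e x y)%N.
Proof.
move=> xy; rewrite /distance; have: (0 < #|T|)%N by apply/card_gt0P; exists x.
case: #|T| => //= n _; rewrite ifN //; apply/existsPn => p.
by rewrite (tuple0 p) /=.
Qed.

Lemma diameter_gt0 : (1 < #|T|)%N -> (0 < diameter e)%N.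
Proof.
move=> /card_gt1P[x [y [_ _ xy]]]; apply: leq_trans (distance_gt0 xy) _.
apply: leq_trans (leq_bigmax x).
by apply: (@leq_bigmax _ (distance e x) y).
Qed.

End GraphFacts.

(** * Comparing the two bounds *)

Section Bounds.
Variables (R : rcfType) (k Delta n D : nat).
Hypotheses (k_ge2 : (2 <= k)%N) (k_le : (k <= Delta)%N) (Delta_lt : (Delta < n)%N)
  (D_gt0 : (0 < D)%N).

Let c : R := k%:R - 1.
Let m : R := n%:R - Delta%:R.
Let X : R := n%:R * (4 * D%:R - 3) - 2.

Let c_ge1 : 1 <= c.
Proof. by have : 2%:R <= k%:R :> R; [rewrite ler_nat | rewrite /c; lra]. Qed.

Let m_ge1 : 1 <= m.
Proof.
have : Delta.+1%:R <= n%:R :> R by rewrite ler_nat.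
by rewrite -natr1 /m; lra.
Qed.

Let Delta_ge : c + 1 <= Delta%:R.
Proof. by have : k%:R <= Delta%:R :> R; [rewrite ler_nat | rewrite /c; lra]. Qed.

Let D_ge1 : 1 <= D%:R :> R.
Proof. by rewrite ler1n. Qed.

Let n_ge : m + c + 1 <= n%:R.
Proof. by move: Delta_ge; rewrite /m; lra. Qed.

Let X_gt0 : 0 < X.
Proof.
move: c_ge1 m_ge1 n_ge D_ge1; rewrite /X; set N := n%:R; set d := D%:R.
by move=> hc hm hn hd; nra.
Qed.

Let den1_gt0 : 0 < n%:R * (D%:R - 1 / 4) :> R.
Proof. by apply: mulr_gt0; move: c_ge1 m_ge1 n_ge D_ge1; lra. Qed.

Let den2_gt0 :
  0 < 2 * m * (n%:R - Delta%:R + 2 * k%:R - 4) + (n%:R + 1) * c ^+ 2.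
Proof.
have -> : n%:R - Delta%:R + 2 * k%:R - 4 = m + 2 * c - 2 by rewrite /m /c; ring.
apply: ltr_wpDl.
  by apply: mulr_ge0; move: c_ge1 m_ge1; lra.
by apply: mulr_gt0; [|apply: exprn_gt0]; move: c_ge1 m_ge1 n_ge; lra.
Qed.

Lemma B1_lt_B2E :
  (B1 R n D < B2 R n Delta k) = (4 * m * (m + 2 * c - 2) < c ^+ 2 * X).
Proof.
rewrite /B1 /B2 -/c -/m ltr_pdivrMr // mulrAC ltr_pdivlMr // mul1r.
by apply/idP/idP; rewrite /X /c /m; lra.
Qed.

Lemma B2_lt_B1E :
  (B2 R n Delta k < B1 R n D) = (c ^+ 2 * X < 4 * m * (m + 2 * c - 2)).
Proof.
rewrite /B1 /B2 -/c -/m ltr_pdivrMr // mulrAC ltr_pdivlMr // mul1r.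
by apply/idP/idP; rewrite /X /c /m; lra.
Qed.

(** Squaring the hypothesis gives c^2 X > 4 m (n + Delta - 4), and
    m + 2 c - 2 <= n + Delta - 4 amounts to k <= Delta. *)
Lemma B1_lt_B2 :
  2 * Num.sqrt (m * (n%:R + Delta%:R - 4) / X) + 1 < k%:R ->
  B1 R n D < B2 R n Delta k.
Proof.
set a := m * (n%:R + Delta%:R - 4) / X => hk; rewrite B1_lt_B2E.
have a_ge0 : 0 <= a.
  apply: divr_ge0; last exact: ltW.
  by apply: mulr_ge0; move: c_ge1 m_ge1 Delta_ge n_ge; lra.
have : (2 * Num.sqrt a) ^+ 2 < c ^+ 2.
  have s_ge0 := sqrtr_ge0 a.
  by rewrite ltr_pXn2r ?nnegrE //; move: c_ge1 hk; rewrite /c; lra.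
rewrite exprMn sqr_sqrtr // -(ltr_pM2r X_gt0).
have -> : 2 ^+ 2 * a * X = 4 * m * (n%:R + Delta%:R - 4).
  by rewrite -mulrA /a divfK ?gt_eqF //; ring.
apply: le_lt_trans; rewrite ler_pM2l; last by move: m_ge1; lra.
by move: Delta_ge; rewrite /m; lra.
Qed.

(** Squaring the hypothesis gives c^2 X < 4 m^2, and m <= m + 2 c - 2 since
    c >= 1. *)
Lemma B2_lt_B1 :
  k%:R < 2 * m / Num.sqrt X + 1 -> B2 R n Delta k < B1 R n D.
Proof.
rewrite -ltrBlDr -/c ltr_pdivlMr ?sqrtr_gt0 // => hk; rewrite B2_lt_B1E.
have : (c * Num.sqrt X) ^+ 2 < (2 * m) ^+ 2.
  have c_ge0 : 0 <= c by move: c_ge1; lra.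
  by rewrite ltr_pXn2r ?nnegrE // ?mulr_ge0 ?sqrtr_ge0 //; move: m_ge1; lra.
rewrite exprMn sqr_sqrtr ?ltW // => /lt_le_trans; apply.
have -> : (2 * m) ^+ 2 = 4 * m * m by ring.
by rewrite ler_pM2l; move: c_ge1 m_ge1; lra.
Qed.

End Bounds.

Theorem mainTheorem3 (R : rcfType) (T : finType) (e : rel T)
    (k Delta n D : nat)
    (hk : (2 <= k)%N)
    (hG : simple_graph e)
    (hconn : k_connected e k)
    (hreg : regular e Delta)
    (hn : n = #|T|)
    (hD : D = diameter e) :
  (k%:R > 2 * Num.sqrt (((n%:R - Delta%:R) * (n%:R + Delta%:R - 4))
                         / (n%:R * (4 * D%:R - 3) - 2)) + 1 :> R ->
   B2 R n Delta k > B1 R n D)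
  /\
  (k%:R < (2 * (n%:R - Delta%:R))
           / Num.sqrt (n%:R * (4 * D%:R - 3) - 2) + 1 :> R ->
   B1 R n D > B2 R n Delta k).
Proof.
case: hG => _ irr.
have /card_gt0P[x _] := k_connected_nonempty (ltnW hk) hconn.
have k_le : (k <= Delta)%N by rewrite -(hreg x); apply: k_connected_degree.
have Delta_lt : (Delta < n)%N by rewrite -(hreg x) hn; apply: degree_lt_card.
have D_gt0 : (0 < D)%N.
  rewrite hD; apply: diameter_gt0; rewrite -hn.
  by apply: leq_ltn_trans Delta_lt; apply: ltnW (leq_trans hk k_le).
by split; [apply: B1_lt_B2 | apply: B2_lt_B1].
Qed.
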